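(* Let $k$ be a commutative unital ring, let $Q$ be a cyclic $k$-module with normalization $j:Q_*\to\bar Q_*$, and let $\varphi:Q_*\to Q_{*+1}$ be a special homotopy associated with $j$. Let $P_*$ be a non-negatively graded $k$-module with differentials $b$ of degree $-1$ and $B$ of degree $+1$ such that $bB=-Bb$. Let $f^{(m)}:P_*\to Q_{*+2m}$ ($m\ge0$) be $k$-linear maps such that the maps $g^{(m)}:=jf^{(m)}:P_*\to\bar Q_{*+2m}$ satisfy $[b,g^{(m)}]+[B,g^{(m-1)}]=0$ for all $m\geq 0$, and such that $[b,f^{(0)}]=0$. Then the maps $h^{(m)}:P_*\to Q_{*+2m}$ defined by $$h^{(m)}:=f^{(m)}+\varphi\sum_{i=1}^m(B\varphi)^{m-i}\big([b,f^{(i)}]+[B,f^{(i-1)}]\big)$$ satisfy $jh^{(m)}=g^{(m)}$ and $[b,h^{(m)}]+[B,h^{(m-1)}]=0$ for all $m\ge0$, and $h^{(0)}=f^{(0)}$.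
   Context: For maps $f$ of even degree, $[b,f]=bf-fb$ and $[B,f]=Bf-fB$; maps with index $m=-1$ are $0$ by convention. A cyclic $k$-module $Q$ is a simplicial $k$-module with operators $t_n:Q_n\to Q_n$ such that $t_n^{n+1}=1$, $d_it_n=t_{n-1}d_{i-1}$ and $s_it_n=t_{n+1}s_{i-1}$ for $1\le i\le n$, $d_0t_n=d_n$, $s_0t_n=t_{n+1}^2s_n$. $Q_*$ is the non-normalized complex with $b=\sum_{i=0}^n(-1)^id_i$ and Connes' operator $B=(1-(-1)^{n+1}t_{n+1})t_{n+1}s_n\sum_{i=0}^n(-1)^{ni}t_n^i:Q_n\to Q_{n+1}$; $\bar Q_n=Q_n/\sum_is_iQ_{n-1}$ and $j$ is the canonical projection, which commutes with $b$ and with $B$ ($B$ on $\bar Q_*$ being induced by $B$ on $Q_*$). A special homotopy associated with $j$: there is a morphism of $b$-complexes $i:\bar Q_*\to Q_*$ with $ji=1$ and $ij=1+b\varphi+\varphi b$, and moreover $\varphi i=0$, $j\varphi=0$, $\varphi^2=0$. *)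

(* Defs.v *)
From HB Require Import structures.
From mathcomp Require Import all_boot all_order all_algebra.
From mathcomp Require Import generic_quotient ring_quotient.
From mathcomp Require Import boolp.

Set Implicit Arguments.
Unset Strict Implicit.
Unset Printing Implicit Defensive.

Import GRing.Theory.
Local Open Scope ring_scope.

(* The graded module with components [V n] is the external direct sum of the
   [V n]: families [x] with [x n : V n] vanishing from some rank on. *)
Section DirectSum.
Variables (k : comPzRingType) (V : nat -> lmodType k).

Record dsum := DSum {
  dcomp :> forall n, V n;
  dcompP : exists N, forall n, (N <= n)%N -> dcomp n = 0 }.

HB.instance Definition _ := gen_eqMixin dsum.
HB.instance Definition _ := gen_choiceMixin dsum.

Lemma dsumP (x y : dsum) : (forall n, x n = y n) -> x = y.
Proof.
case: x y => [x hx] [y hy] /= exy.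
have {}exy : x = y by apply: functional_extensionality_dep.
by case: _ / exy hy => hy; congr DSum; apply: Prop_irrelevance.
Qed.

Fact dsum0_subproof : exists N, forall n, (N <= n)%N -> (0 : V n) = 0.
Proof. by exists 0%N. Qed.

Fact dsumN_subproof (x : dsum) :
  exists N, forall n, (N <= n)%N -> - x n = 0.
Proof. by have [N h] := dcompP x; exists N => n /h ->; rewrite oppr0. Qed.

Fact dsumD_subproof (x y : dsum) :
  exists N, forall n, (N <= n)%N -> x n + y n = 0.
Proof.
have [[N h] [M h']] := (dcompP x, dcompP y); exists (maxn N M) => n.
by rewrite geq_max => /andP[/h -> /h' ->]; rewrite addr0.
Qed.

Fact dsumZ_subproof (a : k) (x : dsum) :
  exists N, forall n, (N <= n)%N -> a *: x n = 0.
Proof. by have [N h] := dcompP x; exists N => n /h ->; rewrite scaler0. Qed.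

Definition dsum0 := DSum dsum0_subproof.
Definition dsumN x := DSum (dsumN_subproof x).
Definition dsumD x y := DSum (dsumD_subproof x y).
Definition dsumZ a x := DSum (dsumZ_subproof a x).

Fact dsumDA : associative dsumD.
Proof. by move=> x y z; apply: dsumP => n /=; rewrite addrA. Qed.
Fact dsumDC : commutative dsumD.
Proof. by move=> x y; apply: dsumP => n /=; rewrite addrC. Qed.
Fact dsumD0 : left_id dsum0 dsumD.
Proof. by move=> x; apply: dsumP => n /=; rewrite add0r. Qed.
Fact dsumDN : left_inverse dsum0 dsumN dsumD.
Proof. by move=> x; apply: dsumP => n /=; rewrite addNr. Qed.

HB.instance Definition _ :=
  GRing.isZmodule.Build dsum dsumDA dsumDC dsumD0 dsumDN.

Fact dsumZA a b x : dsumZ a (dsumZ b x) = dsumZ (a * b) x.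
Proof. by apply: dsumP => n /=; rewrite scalerA. Qed.
Fact dsumZ1 : left_id 1 dsumZ.
Proof. by move=> x; apply: dsumP => n /=; rewrite scale1r. Qed.
Fact dsumZDr : right_distributive dsumZ +%R.
Proof. by move=> a x y; apply: dsumP => n /=; rewrite scalerDr. Qed.
Fact dsumZDl x : {morph dsumZ^~ x : a b / a + b}.
Proof. by move=> a b; apply: dsumP => n /=; rewrite scalerDl. Qed.

HB.instance Definition _ :=
  GRing.Zmodule_isLmodule.Build k dsum dsumZA dsumZ1 dsumZDr dsumZDl.

Lemma dcomp0 n : (0 : dsum) n = 0. Proof. by []. Qed.
Lemma dcompN (x : dsum) n : (- x) n = - x n. Proof. by []. Qed.
Lemma dcompD (x y : dsum) n : (x + y) n = x n + y n. Proof. by []. Qed.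
Lemma dcompZ a (x : dsum) n : (a *: x) n = a *: x n. Proof. by []. Qed.

End DirectSum.

Arguments dsum {k} V.

(* [F] has degree [d]: it maps the elements concentrated in degree [p] to
   elements concentrated in degree [p + d] (hence to 0 if [p + d < 0]). *)
Definition homogeneous (k : comPzRingType) (V W : nat -> lmodType k) (d : int)
    (F : dsum V -> dsum W) :=
  forall (p : nat) (x : dsum V), (forall q, q != p -> x q = 0) ->
  forall r : nat, (r%:Z != p%:Z + d) -> F x r = 0.

Section Lifts.
Variables (k : comPzRingType) (V W : nat -> lmodType k).

Section Lift0.
Variable F : forall n, {linear V n -> W n}.

Fact lift0_subproof (x : dsum V) :
  exists N, forall n, (N <= n)%N -> F n (x n) = 0.
Proof. by have [N h] := dcompP x; exists N => n /h ->; rewrite linear0. Qed.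

Definition lift0 (x : dsum V) : dsum W := DSum (lift0_subproof x).

Fact lift0_linear : linear lift0.
Proof. by move=> a x y; apply: dsumP => n /=; rewrite linearP. Qed.

HB.instance Definition _ :=
  GRing.isLinear.Build k (dsum V) (dsum W) *:%R lift0 lift0_linear.
End Lift0.

Section LiftUp.
Variable F : forall n, {linear V n -> W n.+1}.

Definition lift_up_fun (x : dsum V) (n : nat) : W n :=
  match n with 0 => 0 | m.+1 => F m (x m) end.

Fact lift_up_subproof (x : dsum V) :
  exists N, forall n, (N <= n)%N -> lift_up_fun x n = 0.
Proof.
have [N h] := dcompP x; exists N.+1 => -[//|n] /h /= ->.
by rewrite linear0.
Qed.

Definition lift_up (x : dsum V) : dsum W := DSum (lift_up_subproof x).

Fact lift_up_linear : linear lift_up.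
Proof.
move=> a x y; apply: dsumP => -[|n] /=; last by rewrite linearP.
by rewrite scaler0 addr0.
Qed.

HB.instance Definition _ :=
  GRing.isLinear.Build k (dsum V) (dsum W) *:%R lift_up lift_up_linear.
End LiftUp.

Section LiftDown.
Variable F : forall n, {linear V n.+1 -> W n}.

Fact lift_down_subproof (x : dsum V) :
  exists N, forall n, (N <= n)%N -> F n (x n.+1) = 0.
Proof.
have [N h] := dcompP x; exists N => n /leqW /h ->.
by rewrite linear0.
Qed.

Definition lift_down (x : dsum V) : dsum W := DSum (lift_down_subproof x).

Fact lift_down_linear : linear lift_down.
Proof. by move=> a x y; apply: dsumP => n /=; rewrite linearP. Qed.

HB.instance Definition _ :=
  GRing.isLinear.Build k (dsum V) (dsum W) *:%R lift_down lift_down_linear.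
End LiftDown.
End Lifts.

(* The operators are indexed by [nat], but only [face n i] with [i <= n.+1]
   (the map d_i from degree n+1 to degree n) and [degen n i] with [i <= n]
   (the map s_i from degree n to degree n+1) are meaningful; nothing is
   required of, and no use is made of, the other ones. *)
Record cyclicModule (k : comPzRingType) := CyclicModule {
  cobj :> nat -> lmodType k;
  face : forall n : nat, nat -> {linear cobj n.+1 -> cobj n};
  degen : forall n : nat, nat -> {linear cobj n -> cobj n.+1};
  cyc : forall n : nat, {linear cobj n -> cobj n};
  face_face : forall (n i j : nat) (x : cobj n.+2),
    (i < j <= n.+2)%N ->
    face n i (face n.+1 j x) = face n j.-1 (face n.+1 i x);
  degen_degen : forall (n i j : nat) (x : cobj n),
    (i <= j <= n)%N ->
    degen n.+1 i (degen n j x) = degen n.+1 j.+1 (degen n i x);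
  face_degen_lt : forall (n i j : nat) (x : cobj n.+1),
    (i < j <= n.+1)%N ->
    face n.+1 i (degen n.+1 j x) = degen n j.-1 (face n i x);
  face_degen_eq : forall (n j : nat) (x : cobj n),
    (j <= n)%N -> face n j (degen n j x) = x;
  face_degen_eqS : forall (n j : nat) (x : cobj n),
    (j <= n)%N -> face n j.+1 (degen n j x) = x;
  face_degen_gt : forall (n i j : nat) (x : cobj n.+1),
    (j.+1 < i <= n.+2)%N ->
    face n.+1 i (degen n.+1 j x) = degen n j (face n i.-1 x);
  cyc_iter : forall (n : nat) (x : cobj n), iter n.+1 (cyc n) x = x;
  face_cyc : forall (n i : nat) (x : cobj n.+1),
    (1 <= i <= n.+1)%N -> face n i (cyc n.+1 x) = cyc n (face n i.-1 x);
  degen_cyc : forall (n i : nat) (x : cobj n),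
    (1 <= i <= n)%N -> degen n i (cyc n x) = cyc n.+1 (degen n i.-1 x);
  face0_cyc : forall (n : nat) (x : cobj n.+1),
    face n 0 (cyc n.+1 x) = face n n.+1 x;
  degen0_cyc : forall (n : nat) (x : cobj n),
    degen n 0 (cyc n x) = cyc n.+1 (cyc n.+1 (degen n n x)) }.

Arguments face {k} c n i : rename.
Arguments degen {k} c n i : rename.
Arguments cyc {k} c n : rename.

Section CyclicModule.
Variables (k : comPzRingType) (Q : cyclicModule k).

Definition bcomp (n : nat) (x : Q n.+1) : Q n :=
  \sum_(0 <= i < n.+2) (-1) ^+ i *: face Q n i x.

Definition cnorm (n : nat) (x : Q n) : Q n :=
  \sum_(0 <= i < n.+1) (-1) ^+ (n * i) *: iter i (cyc Q n) x.

Definition extra (n : nat) (x : Q n) : Q n.+1 := cyc Q n.+1 (degen Q n n x).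

Definition Bcomp (n : nat) (x : Q n) : Q n.+1 :=
  let y := extra (cnorm x) in y - (-1) ^+ n.+1 *: cyc Q n.+1 y.

Fact bcomp_linear n : linear (@bcomp n).
Proof.
move=> a x y; rewrite /bcomp scaler_sumr -big_split /=.
by apply: eq_bigr => i _; rewrite linearP scalerDr !scalerA mulrC.
Qed.

HB.instance Definition _ n :=
  GRing.isLinear.Build k (Q n.+1) (Q n) *:%R (@bcomp n) (@bcomp_linear n).

Fact iter_cyc_linear n i : linear (iter i (cyc Q n)).
Proof. by elim: i => [|i IH] a x y; rewrite ?iterS ?IH ?linearP. Qed.

Fact cnorm_linear n : linear (@cnorm n).
Proof.
move=> a x y; rewrite /cnorm scaler_sumr -big_split /=.
by apply: eq_bigr => i _; rewrite iter_cyc_linear scalerDr !scalerA mulrC.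
Qed.

HB.instance Definition _ n :=
  GRing.isLinear.Build k (Q n) (Q n) *:%R (@cnorm n) (@cnorm_linear n).

Fact extra_linear n : linear (@extra n).
Proof. by move=> a x y; rewrite /extra !linearP. Qed.

HB.instance Definition _ n :=
  GRing.isLinear.Build k (Q n) (Q n.+1) *:%R (@extra n) (@extra_linear n).

Fact Bcomp_linear n : linear (@Bcomp n).
Proof.
move=> a x y; rewrite /Bcomp !linearP /=.
by rewrite scalerDr addrACA.
Qed.

HB.instance Definition _ n :=
  GRing.isLinear.Build k (Q n) (Q n.+1) *:%R (@Bcomp n) (@Bcomp_linear n).

Definition degenerate (n : nat) : Q n -> Prop :=
  match n with
  | 0 => fun x => x = 0
  | m.+1 => fun x => exists y : nat -> Q m,
              x = \sum_(0 <= i < m.+1) degen Q m i (y i)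
  end.

Arguments degenerate : simpl never.

Definition degenerate_pred (n : nat) : {pred Q n} :=
  fun x => `[< degenerate x >].

Lemma degenerate_linear n a (x y : Q n) :
  degenerate x -> degenerate y -> degenerate (a *: x + y).
Proof.
case: n x y => [|n] x y; first by move=> -> ->; rewrite scaler0 addr0.
move=> [u ->] [v ->]; exists (fun i => a *: u i + v i).
rewrite scaler_sumr -big_split /=.
by apply: eq_bigr => i _; rewrite linearP.
Qed.

Lemma degenerate0 n : degenerate (0 : Q n).
Proof.
case: n => [//|n]; exists (fun=> 0).
by rewrite big1 // => i _; rewrite linear0.
Qed.

Fact degenerate_submod n : submod_closed (@degenerate_pred n).
Proof.
split; first exact/asboolP/degenerate0.
by move=> a x y /asboolP hx /asboolP hy; exact/asboolP/degenerate_linear.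
Qed.

HB.instance Definition _ n :=
  GRing.isSubmodClosed.Build k (Q n) (@degenerate_pred n) (degenerate_submod n).

Lemma degenerate_sum n (I : Type) (r : seq I) (P : pred I) (F : I -> Q n) :
  (forall i, P i -> degenerate (F i)) -> degenerate (\sum_(i <- r | P i) F i).
Proof.
move=> hF; apply: big_ind => //; first exact: degenerate0.
by move=> x y hx hy; rewrite -[x]scale1r; apply: degenerate_linear.
Qed.

Lemma degenerateZ n a (x : Q n) : degenerate x -> degenerate (a *: x).
Proof.
by move=> hx; rewrite -[_ *: _]addr0; apply: degenerate_linear => //;
  apply: degenerate0.
Qed.

Lemma degenerate_degen n i (x : Q n) : (i <= n)%N -> degenerate (degen Q n i x).
Proof.
move=> lein; exists (fun j => if j == i then x else 0).
rewrite (bigD1_seq i) ?iota_uniq ?mem_index_iota ?ltnS //= eqxx.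
by rewrite big1 ?addr0 // => j /negPf ->; rewrite linear0.
Qed.

Lemma bcomp_degenerate n (x : Q n.+1) : degenerate x -> degenerate (bcomp x).
Proof.
move=> [y ->]; rewrite linear_sum big_seq; apply: degenerate_sum => j.
rewrite mem_index_iota /= ltnS => lejn; rewrite /bcomp.
rewrite (@big_cat_nat _ _ _ j) //=; last by rewrite ltnW // ltnW.
rewrite (@big_cat_nat _ _ _ j.+2 j) //=; last by rewrite ltnW.
rewrite [X in _ + (X + _)]big_nat_recl // big_nat1.
rewrite face_degen_eq // face_degen_eqS // exprS mulN1r scaleNr subrr add0r.
rewrite -[X in degenerate (X + _)]scale1r.
case: n y lejn {x} => [|n] y lejn.
  move: lejn; rewrite leqn0 => /eqP ->.
  by rewrite !big_geq // scaler0 addr0.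
apply: degenerate_linear; rewrite big_seq; apply: degenerate_sum => i;
  rewrite mem_index_iota => hi; apply: degenerateZ.
- move: hi => /= ltij; rewrite face_degen_lt ?ltij //.
  by apply: degenerate_degen; case: (j) lejn ltij.
- rewrite face_degen_gt //; apply: degenerate_degen.
  by have /andP[h1 h2] := hi; move: (leq_trans h1 h2); rewrite !ltnS.
Qed.

(* Rotations preserve the span of the degenerate elements and of the image
   of the extra degeneracy. *)
Definition degenerate_extra n (x : Q n.+1) :=
  exists u v, degenerate u /\ x = u + extra v.

Lemma degenerate_extra_cyc n (x : Q n.+1) :
  degenerate_extra x -> degenerate_extra (cyc Q n.+1 x).
Proof.
move=> [u [v [[y ->] ->]]].
exists (\sum_(0 <= i < n) degen Q n i.+1 (cyc Q n (y i)) +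
        degen Q n 0 (cyc Q n v)), (y n).
split.
  rewrite -[X in degenerate (X + _)]scale1r; apply: degenerate_linear;
    last exact: degenerate_degen.
  rewrite big_seq; apply: degenerate_sum => i.
  by rewrite mem_index_iota => ?; apply: degenerate_degen.
rewrite linearD linear_sum big_nat_recr //= /extra degen0_cyc addrAC.
congr (_ + _ + _); apply: eq_big_nat => i /= ltin.
by rewrite degen_cyc.
Qed.

Lemma extra_degenerate_extra n (x : Q n.+1) :
  degenerate_extra x -> degenerate (extra x).
Proof.
move=> [u [v [[y ->] ->]]]; rewrite linearD linear_sum /=.
rewrite -[X in degenerate (X + _)]scale1r; apply: degenerate_linear.
  rewrite big_seq; apply: degenerate_sum => i.
  rewrite mem_index_iota => /= lein; rewrite /extra.
  rewrite -degen_degen ?leqnn ?andbT // -[i]/(i.+1.-1) -degen_cyc //.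
  exact: degenerate_degen.
rewrite /extra degen_cyc ?leqnn //= degen_degen ?leqnn // -degen0_cyc; exact: degenerate_degen.
Qed.

Lemma Bcomp_degenerate n (x : Q n) : degenerate x -> degenerate (Bcomp x).
Proof.
case: n x => [x -> |n x hx]; first by rewrite linear0; apply: degenerate0.
rewrite /Bcomp /= {2}/extra -degen0_cyc addrC -scaleNr.
apply: degenerate_linear; first exact: degenerate_degen.
rewrite /cnorm linear_sum; apply: degenerate_sum => i _.
rewrite linearZ; apply: degenerateZ; apply: extra_degenerate_extra.
elim: i => [|i IH] /=; last exact: degenerate_extra_cyc.
by exists x, 0; split; rewrite // linear0 addr0.
Qed.

Local Open Scope quotient_scope.

Definition norm_quot (n : nat) := @Quotient.quot (Q n) (@degenerate_pred n).

HB.instance Definition _ n := GRing.Zmodule.on (norm_quot n).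

Definition jcomp (n : nat) (x : Q n) : norm_quot n := \pi_(norm_quot n) x.

Lemma jcompE n (x y : Q n) : (jcomp x = jcomp y) <-> degenerate (x - y).
Proof.
split=> [/eqP|h]; first by rewrite -Quotient.idealrBE => /asboolP.
by apply/eqP; rewrite -Quotient.idealrBE; apply/asboolP.
Qed.

Lemma jcompD n (x y : Q n) : jcomp (x + y) = jcomp x + jcomp y.
Proof. exact: Quotient.pi_add. Qed.

Lemma jcompK n (x : norm_quot n) : jcomp (repr x) = x.
Proof. exact: reprK. Qed.

Definition norm_scale n (a : k) (x : norm_quot n) : norm_quot n :=
  jcomp (a *: repr x).

Lemma jcompZ n a (x : Q n) : jcomp (a *: x) = norm_scale a (jcomp x).
Proof.
apply/jcompE; rewrite -scalerBr; apply: degenerateZ.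
by apply/jcompE; rewrite jcompK.
Qed.

Fact norm_scaleA n a b (x : norm_quot n) :
  norm_scale a (norm_scale b x) = norm_scale (a * b) x.
Proof. by rewrite -[x]jcompK -!jcompZ scalerA. Qed.
Fact norm_scale1 n : left_id 1 (@norm_scale n).
Proof. by move=> x; rewrite -[x]jcompK -jcompZ scale1r. Qed.
Fact norm_scaleDr n : right_distributive (@norm_scale n) +%R.
Proof.
move=> a x y; rewrite -[x]jcompK -[y]jcompK -jcompD -!jcompZ.
by rewrite scalerDr jcompD.
Qed.
Fact norm_scaleDl n (x : norm_quot n) :
  {morph (@norm_scale n)^~ x : a b / a + b}.
Proof. by move=> a b; rewrite -[x]jcompK -!jcompZ scalerDl jcompD. Qed.

HB.instance Definition _ n := GRing.Zmodule_isLmodule.Build k (norm_quot n)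
  (@norm_scaleA n) (@norm_scale1 n) (@norm_scaleDr n) (@norm_scaleDl n).

Definition normalization (n : nat) : lmodType k := norm_quot n.

Fact jcomp_linear n : linear (@jcomp n : Q n -> normalization n).
Proof. by move=> a x y; rewrite jcompD jcompZ. Qed.

HB.instance Definition _ n := GRing.isLinear.Build k (Q n) (normalization n)
  *:%R (@jcomp n) (@jcomp_linear n).

(* The induced operators are defined through representatives; by [jcomp_bcomp]
   and [jcomp_Bcomp] below they do not depend on the choice. *)
Definition bbarcomp (n : nat) (x : normalization n.+1) : normalization n :=
  jcomp (bcomp (repr (x : norm_quot n.+1))).

Definition Bbarcomp (n : nat) (x : normalization n) : normalization n.+1 :=
  jcomp (Bcomp (repr (x : norm_quot n))).

Lemma jcomp_bcomp n (x : Q n.+1) : jcomp (bcomp x) = bbarcomp (jcomp x).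
Proof.
apply/jcompE; rewrite -linearB; apply: bcomp_degenerate.
by apply/jcompE; rewrite jcompK.
Qed.

Lemma jcomp_Bcomp n (x : Q n) : jcomp (Bcomp x) = Bbarcomp (jcomp x).
Proof.
apply/jcompE; rewrite -linearB; apply: Bcomp_degenerate.
by apply/jcompE; rewrite jcompK.
Qed.

Fact bbarcomp_linear n : linear (@bbarcomp n).
Proof.
move=> a x y; rewrite -[x](@jcompK n.+1) -[y](@jcompK n.+1).
by rewrite -linearP -!jcomp_bcomp !linearP.
Qed.

HB.instance Definition _ n := GRing.isLinear.Build k
  (normalization n.+1) (normalization n) *:%R (@bbarcomp n) (@bbarcomp_linear n).

Fact Bbarcomp_linear n : linear (@Bbarcomp n).
Proof.
move=> a x y; rewrite -[x](@jcompK n) -[y](@jcompK n).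
by rewrite -linearP -!jcomp_Bcomp !linearP.
Qed.

HB.instance Definition _ n := GRing.isLinear.Build k
  (normalization n) (normalization n.+1) *:%R (@Bbarcomp n) (@Bbarcomp_linear n).

(* [lift_down] makes [bQ] and [bbar] vanish in degree 0. *)
Definition bQ : {linear dsum Q -> dsum Q} := lift_down (fun n => @bcomp n).
Definition BQ : {linear dsum Q -> dsum Q} := lift_up (fun n => @Bcomp n).
Definition bbar : {linear dsum normalization -> dsum normalization} :=
  lift_down (fun n => @bbarcomp n).
Definition Bbar : {linear dsum normalization -> dsum normalization} :=
  lift_up (fun n => @Bbarcomp n).
Definition jQ : {linear dsum Q -> dsum normalization} :=
  lift0 (fun n => @jcomp n : {linear Q n -> normalization n}).

End CyclicModule.

Definition special_homotopy (k : comPzRingType) (Q : cyclicModule k)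
    (phi : {linear dsum Q -> dsum Q}) :=
  homogeneous 1 phi /\
  exists i : {linear dsum (normalization Q) -> dsum Q},
    homogeneous 0 i /\
    (forall x, bQ Q (i x) = i (bbar Q x)) /\
    (forall x, jQ Q (i x) = x) /\
    (forall x, i (jQ Q x) = x + bQ Q (phi x) + phi (bQ Q x)) /\
    (forall x, phi (i x) = 0) /\
    (forall x, jQ Q (phi x) = 0) /\
    (forall x, phi (phi x) = 0).

Section Brackets.
Variables (k : comPzRingType) (V W : nat -> lmodType k).

(* [d, F] = d F - F d, with [dV] and [dW] the two incarnations of [d]; this is
   the graded commutator because it is only used for [F] of even degree. *)
Definition bracket (dV : dsum V -> dsum V) (dW : dsum W -> dsum W)
    (F : dsum V -> dsum W) : dsum V -> dsum W :=
  fun x => dW (F x) - F (dV x).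

(* F^{(m-1)}, with F^{(-1)} = 0 *)
Definition shift_index (F : nat -> dsum V -> dsum W) (m : nat) : dsum V -> dsum W :=
  match m with 0 => fun=> 0 | m'.+1 => F m' end.

End Brackets.

Definition hmap (k : comPzRingType) (Q : cyclicModule k)
    (P : nat -> lmodType k) (phi : dsum Q -> dsum Q) (b B : dsum P -> dsum P)
    (f : nat -> dsum P -> dsum Q) (m : nat) : dsum P -> dsum Q :=
  fun x => f m x +
    phi (\sum_(1 <= i < m.+1)
           iter (m - i) (BQ Q \o phi)
             (bracket b (bQ Q) (f i) x + bracket B (BQ Q) (shift_index f i) x)).

(* Main.v *)
From HB Require Import structures.
Require Import Defs.
From mathcomp Require Import all_boot all_order all_algebra.

Set Implicit Arguments.
Unset Strict Implicit.
Unset Printing Implicit Defensive.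

Import GRing.Theory.
Local Open Scope ring_scope.


(** The correction term of [h m] is [phi (S m)], where
    [S m = sum_(1 <= i <= m) (B phi)^(m-i) e_i] is built from the defects
    [e_i = [b, f_i] + [B, f_(i-1)]] and obeys [S (m+1) = e_(m+1) + B phi (S m)]
    ([correctionS]).  The normalization [j] kills every [e_i] since it commutes
    with [b] and [B], hence it kills every [S m] as [j phi = 0]
    ([jcorrection]).  On the kernel of [j] the identity
    [i j = 1 + b phi + phi b] reads [y = - b phi y - phi b y], so that
    [[b, h_m] + [B, h_(m-1)] = S m + [b, phi (S m)] - phi (S (m-1)) B
                             = - phi (b (S m) + (S m) b + (S (m-1)) B)].

    The last parenthesis is zero ([correction_cocycle]).  Indeed the defects are
    the components of the commutator of [b + B] with [sum_m f_m], so they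
    anticommute with [b + B] ([defect_cocycle]); expanding [S m] by its
    recursion and using the contraction once more expresses the parenthesis at
    rank [m+1] as [B phi] applied to the parenthesis at rank [m], which is zero
    at rank [0] because [S 0 = 0].

    This needs [b b = 0], [B B = 0] and [b B = - B b] on the non-normalized
    complex of the cyclic module, which are consequences of the simplicial and
    cyclic relations ([bQ_bQ], [BQ_BQ], [bQ_BQ]). *)

(** * The mixed complex of a cyclic module *)

(** By induction on [m]: the terms added when [m] grows by one are the new row
    [F m j], [j <= m + 1], and the new column [F i m.+1], [i < m]; the
    hypothesis cancels [F i m.+1] against [F m i] for every [i <= m]. *)
Lemma sum_face_cancel (V : zmodType) (F : nat -> nat -> V) (m : nat) :
  (forall i j, (i <= j < m)%N -> F i j.+1 = - F j i) ->
  \sum_(0 <= i < m) \sum_(0 <= j < m.+1) F i j = 0.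
Proof.
elim: m => [|m IH] hF; first by rewrite big_geq.
rewrite big_nat_recr //=.
under [X in X + _]eq_bigr => i _ do rewrite big_nat_recr //=.
rewrite big_split /= IH ?add0r; last first.
  by move=> i j /andP[leij ltjm]; apply: hF; rewrite leij ltnW.
rewrite (eq_big_nat _ _ (F2 := fun i => - F m i)); last first.
  by move=> i /andP[_ ltim]; apply: hF; rewrite ltnW ?ltnSn.
rewrite big_nat_recr //= big_nat_recr //= sumrN hF ?leqnn ?ltnSn //.
by rewrite addrK addNr.
Qed.

Section CyclicIdentities.
Variables (k : comPzRingType) (Q : cyclicModule k).

(** The signed generator: absorbing the sign [(-1)^n] into [cyc], and [(-1)^i]
    into [face i], frees all the identities below from signs. *)
Definition lam n (x : Q n) : Q n := (-1) ^+ n *: cyc Q n x.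

Fact lam_linear n : linear (@lam n).
Proof. by move=> a x y; rewrite /lam linearP scalerDr !scalerA mulrC. Qed.

HB.instance Definition _ n :=
  GRing.isLinear.Build k (Q n) (Q n) *:%R (@lam n) (@lam_linear n).

Definition sface n i (x : Q n.+1) : Q n := (-1) ^+ i *: face Q n i x.

Fact sface_linear n i : linear (@sface n i).
Proof. by move=> a x y; rewrite /sface linearP scalerDr !scalerA mulrC. Qed.

HB.instance Definition _ n i :=
  GRing.isLinear.Build k (Q n.+1) (Q n) *:%R (@sface n i) (@sface_linear n i).

(** The differential of the bar complex, [bcomp] without its last face. *)
Definition bprime n (x : Q n.+1) : Q n := \sum_(0 <= i < n.+1) sface i x.

Lemma bcompE n (x : Q n.+1) : bcomp x = bprime x + sface n.+1 x.
Proof. by rewrite /bcomp big_nat_recr. Qed.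

Lemma iter_lam n i (x : Q n) :
  iter i (@lam n) x = (-1) ^+ (n * i) *: iter i (cyc Q n) x.
Proof.
elim: i => [|i IH]; first by rewrite muln0 scale1r.
by rewrite !iterS IH /lam linearZ scalerA -exprD mulnS.
Qed.

Lemma cnormE n (x : Q n) : cnorm x = \sum_(0 <= i < n.+1) iter i (@lam n) x.
Proof. by apply: eq_bigr => i _; rewrite iter_lam. Qed.

Lemma lam_order n (x : Q n) : iter n.+1 (@lam n) x = x.
Proof.
by rewrite iter_lam cyc_iter -signr_odd oddM /= andbN scale1r.
Qed.

Lemma cnorm_lam n (x : Q n) : cnorm (lam x) = cnorm x.
Proof.
rewrite !cnormE big_nat_recr // [RHS]big_nat_recl //=.
rewrite -iterSr lam_order addrC; congr (_ + _).
by apply: eq_bigr => i _; rewrite -iterSr.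
Qed.

Lemma lam_cnorm n (x : Q n) : lam (cnorm x) = cnorm x.
Proof.
rewrite -[RHS]cnorm_lam !cnormE linear_sum.
by apply: eq_bigr => i _; rewrite -iterS iterSr.
Qed.

Lemma iter_lam_cnorm n i (x : Q n) : iter i (@lam n) (cnorm x) = cnorm x.
Proof. by elim: i => // i IH; rewrite iterS IH lam_cnorm. Qed.

Lemma cnorm_iter_lam n i (x : Q n) : cnorm (iter i (@lam n) x) = cnorm x.
Proof. by elim: i => // i IH; rewrite iterS cnorm_lam. Qed.

Lemma sface_lam n i (x : Q n.+1) :
  (i <= n)%N -> sface i.+1 (lam x) = lam (sface i x).
Proof.
move=> lein; rewrite /sface /lam !linearZ /= face_cyc //= !scalerA -!exprD.
by congr (_ *: _); rewrite addSn addnS !exprS mulrA mulrNN mul1r mul1r addnC.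
Qed.

Lemma sface0_lam n (x : Q n.+1) : sface 0 (lam x) = sface n.+1 x.
Proof. by rewrite /sface /lam linearZ /= face0_cyc scale1r. Qed.

(** All the signed faces are conjugates [lam^i d_0 lam^(-i)] of the first one;
    this is what makes norms and differentials commute. *)
Lemma sface_iter_lam n i (x : Q n.+1) :
  (i <= n.+1)%N -> sface i (iter i (@lam n.+1) x) = iter i (@lam n) (sface 0 x).
Proof.
elim: i => // i IH lein; rewrite !iterS sface_lam //.
by rewrite IH // ltnW.
Qed.

(** [b (1 - lam) = (1 - lam) b']: [lam] shifts the faces of [b'], and the
    remaining face [d_0 lam] of [b lam] is the last face of [b]. *)
Lemma bcomp_sub_lam n (x : Q n.+1) :
  bcomp (x - lam x) = bprime x - lam (bprime x).
Proof.
rewrite linearB /= bcompE /bcomp big_nat_recl //.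
rewrite -[(-1) ^+ 0 *: _]/(sface 0 (lam x)) sface0_lam.
rewrite opprD addrA addrK; congr (_ - _).
rewrite linear_sum; apply: eq_big_nat => i /= ltin.
by rewrite -sface_lam.
Qed.

(** [b' N = N b], as both sides are [N d_0 N]: conjugating the faces by powers
    of [lam], the powers on one side are absorbed by the norm, and those on the
    other side add up to a second norm. *)
Lemma bprime_cnorm n (x : Q n.+1) : bprime (cnorm x) = cnorm (bcomp x).
Proof.
transitivity (cnorm (sface 0 (cnorm x))).
  (* d_i = lam^i d_0 on norms, and the n+1 faces of b' give all the powers *)
  rewrite /bprime [RHS]cnormE; apply: eq_big_nat => i /= ltin.
  by rewrite -[in LHS](iter_lam_cnorm i) sface_iter_lam // ltnW.
(* N x = N (lam x) shifts the exponents to 1, .., n+2; read backwards, they are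
   the exponents n+2-i that bring the face i back to the face 0. *)
rewrite -[X in sface 0 X]cnorm_lam [X in sface 0 X]cnormE /bcomp !linear_sum.
rewrite big_nat_rev /= add0n.
apply: eq_big_nat => i /= ltin; rewrite -/(sface i x) -iterSr subSS.
have le1 : (i <= n.+2)%N by rewrite ltnW.
rewrite -[in RHS](lam_order x) -[in RHS](subnKC le1) iterD.
by rewrite sface_iter_lam // cnorm_iter_lam -subSn.
Qed.

(** The extra degeneracy contracts the bar complex:
    [b' extra + extra b' = 1], where [b' = 0] in degree 0. *)
Lemma bprime_extra0 (x : Q 0) : bprime (extra x) = x.
Proof.
rewrite /bprime big_nat1 /sface /extra scale1r face0_cyc.
by rewrite face_degen_eqS.
Qed.

Lemma bprime_extra n (x : Q n.+1) :
  bprime (extra x) = x - extra (bprime x).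
Proof.
rewrite /bprime big_nat_recl // {1}/sface /extra scale1r face0_cyc.
rewrite face_degen_eqS //; congr (_ + _).
rewrite !linear_sum; apply: eq_big_nat => i /= ltin.
rewrite /sface face_cyc ?ltnS ?(ltnW ltin) //= face_degen_lt ?ltin ?leqnn //.
by rewrite !linearZ /= exprS mulN1r scaleNr scalerN.
Qed.

Lemma BcompE n (x : Q n) :
  Bcomp x = extra (cnorm x) - lam (extra (cnorm x)).
Proof. by []. Qed.

(** The simplicial identity [d_i d_(j+1) = d_j d_i] for [i <= j]. *)
Lemma bcomp_bcomp n (x : Q n.+2) : bcomp (bcomp x) = 0.
Proof.
transitivity (\sum_(0 <= i < n.+2) \sum_(0 <= j < n.+3) sface i (sface j x)).
  by apply: eq_bigr => i _; rewrite -linear_sum.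
apply: sum_face_cancel => i j /andP[leij ltjn].
rewrite /sface !linearZ /= face_face ?ltnS ?leij //.
by rewrite exprS mulN1r scaleNr !scalerN.
Qed.

(** [N (1 - lam) = 0]. *)
Lemma Bcomp_Bcomp n (x : Q n) : Bcomp (Bcomp x) = 0.
Proof.
rewrite BcompE; suff -> : cnorm (Bcomp x) = 0 by rewrite !linear0 addr0.
by rewrite BcompE linearB /= cnorm_lam subrr.
Qed.

Lemma bcomp_Bcomp0 (x : Q 0) : bcomp (Bcomp x) = 0.
Proof. by rewrite BcompE bcomp_sub_lam bprime_extra0 lam_cnorm subrr. Qed.

(** With [B = (1 - lam) extra N]:
    [b B = (1 - lam) b' extra N = (1 - lam) N - (1 - lam) extra b' N
         = - (1 - lam) extra N b]. *)
Lemma bcomp_Bcomp n (x : Q n.+1) : bcomp (Bcomp x) = - Bcomp (bcomp x).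
Proof.
rewrite !BcompE bcomp_sub_lam bprime_extra bprime_cnorm linearB /= lam_cnorm.
by rewrite !opprB addrC addrA subrK.
Qed.

Lemma bQ_bQ x : bQ Q (bQ Q x) = 0.
Proof. by apply: dsumP => n; apply: bcomp_bcomp. Qed.

Lemma BQ_BQ x : BQ Q (BQ Q x) = 0.
Proof.
apply: dsumP => -[|[|n]] //=; first exact: linear0.
exact: Bcomp_Bcomp.
Qed.

Lemma bQ_BQ x : bQ Q (BQ Q x) = - BQ Q (bQ Q x).
Proof.
apply: dsumP => -[|n] /=; first by rewrite bcomp_Bcomp0 oppr0.
exact: bcomp_Bcomp.
Qed.

Lemma jQ_bQ x : jQ Q (bQ Q x) = bbar Q (jQ Q x).
Proof. by apply: dsumP => n; apply: jcomp_bcomp. Qed.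

Lemma jQ_BQ x : jQ Q (BQ Q x) = Bbar Q (jQ Q x).
Proof.
apply: dsumP => -[|n]; last exact: jcomp_Bcomp.
exact: (linear0 (@jcomp k Q 0 : {linear Q 0%N -> normalization Q 0})).
Qed.

End CyclicIdentities.

(** * Degrees *)

Section Homogeneous.
Variable k : comPzRingType.
Implicit Types U V W : nat -> lmodType k.

(** When [p + d] is negative, [F] already vanishes in degree [p]; otherwise
    [F x] is concentrated in the natural number [p + d]. *)
Lemma homogeneous_comp U V W d e (F : dsum U -> dsum V)
    (G : {linear dsum V -> dsum W}) :
  homogeneous d F -> homogeneous e G -> homogeneous (d + e) (G \o F).
Proof.
move=> hF hG p x hx r; rewrite addrA /=.
case def_q: (p%:Z + d) => [q|q] hr.
- by apply: hG hr => s neq_sq; apply: hF hx _ _; rewrite def_q.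
- have -> : F x = 0; last by rewrite linear0.
  by apply: dsumP => s; apply: hF hx _ _; rewrite def_q.
Qed.

Lemma homogeneousD V W d (F G : dsum V -> dsum W) :
  homogeneous d F -> homogeneous d G -> homogeneous d (fun x => F x + G x).
Proof. by move=> hF hG p x hx r hr; rewrite /= (hF p) // (hG p) // addr0. Qed.

Lemma homogeneousN V W d (F : dsum V -> dsum W) :
  homogeneous d F -> homogeneous d (fun x => - F x).
Proof. by move=> hF p x hx r hr; rewrite /= (hF p) // oppr0. Qed.

Lemma homogeneous_bQ (Q : cyclicModule k) : homogeneous (-1) (bQ Q).
Proof.
move=> p x hx r hr /=; rewrite hx ?linear0 //.
by apply: contra hr => /eqP <-; rewrite -addn1 PoszD addrK.
Qed.

Lemma homogeneous_BQ (Q : cyclicModule k) : homogeneous 1 (BQ Q).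
Proof.
move=> p x hx [//|r] hr /=; rewrite hx ?linear0 //.
by apply: contra hr => /eqP ->; rewrite -PoszD addn1.
Qed.

End Homogeneous.

(** * Commutators with anticommuting differentials *)

Section GradedCommutator.
Variables (k : comPzRingType) (P W : nat -> lmodType k).
Implicit Types (d D : {linear dsum P -> dsum P}).
Implicit Types (dW DW : {linear dsum W -> dsum W}).
Implicit Type F : {linear dsum P -> dsum W}.

Lemma bracket_linear d dW F : linear (bracket d dW F).
Proof. by move=> a x y; rewrite /bracket !linearP /= scalerDr addrACA. Qed.

Lemma bracket_square0 d dW F x :
  (forall z, d (d z) = 0) -> (forall y, dW (dW y) = 0) ->
  dW (bracket d dW F x) + bracket d dW F (d x) = 0.
Proof.
move=> hd hdW.
by rewrite /bracket linearB /= hd hdW linear0 sub0r subr0 addNr.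
Qed.

Lemma bracket_anticommute d D dW DW F x :
  (forall z, d (D z) = - D (d z)) -> (forall y, dW (DW y) = - DW (dW y)) ->
  dW (bracket D DW F x) + bracket D DW F (d x) +
  (DW (bracket d dW F x) + bracket d dW F (D x)) = 0.
Proof.
move=> hd hdW; rewrite /bracket !linearB /= hdW hd linearN /= opprK.
set p := DW (dW _); set q := dW (F _); set r := DW (F _); set s := F _.
have -> : - p - q + (r - s) = - (p - r + (q + s)).
  by rewrite !opprD opprK addrACA.
by rewrite addNr.
Qed.

End GradedCommutator.

(** * Correcting a family that is a morphism modulo the kernel of a contraction *)

Section Correction.
Variables (k : comPzRingType) (P W Wbar : nat -> lmodType k).
Variables (b B : {linear dsum P -> dsum P}) (bW BW : {linear dsum W -> dsum W}).
Variables (phi : {linear dsum W -> dsum W}).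
Variable f : nat -> {linear dsum P -> dsum W}.

Definition defect m : dsum P -> dsum W := fun x =>
  bracket b bW (f m) x + bracket B BW (shift_index (fun i => f i) m) x.

Definition correction m : dsum P -> dsum W := fun x =>
  \sum_(1 <= i < m.+1) iter (m - i) (BW \o phi) (defect i x).

(** Lets the case [m = 0], where the shifted map is zero, be treated like the
    others by the lemmas on brackets of linear maps. *)
Lemma shift_index_linear m : exists G : {linear dsum P -> dsum W},
  shift_index (fun i => f i) m = G.
Proof. by case: m => [|m]; [exists \0 | exists (f m)]. Qed.

Lemma defect_linear m : linear (defect m).
Proof.
move=> a x y; rewrite /defect; have [G ->] := shift_index_linear m.
by rewrite !bracket_linear addrACA -scalerDr.
Qed.

Lemma correctionS m x :
  correction m.+1 x = defect m.+1 x + BW (phi (correction m x)).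
Proof.
rewrite /correction big_nat_recr //= subnn addrC; congr (_ + _).
rewrite !linear_sum; apply: eq_big_nat => i /andP[_ lti].
by rewrite subSn.
Qed.

Lemma correction_linear m : linear (correction m).
Proof.
elim: m => [|m IH] a x y.
  by rewrite /correction !big_geq // scaler0 addr0.
by rewrite !correctionS defect_linear IH !linearP /= addrACA -scalerDr.
Qed.

Section Homogeneity.
Hypotheses (hb : homogeneous (-1) b) (hB : homogeneous 1 B).
Hypotheses (hbW : homogeneous (-1) bW) (hBW : homogeneous 1 BW).
Hypothesis hphi : homogeneous 1 phi.
Hypothesis hf : forall m, homogeneous (2 * m)%N%:Z (f m).

Lemma homogeneous_bracket d e (dP : {linear dsum P -> dsum P})
    (dW : {linear dsum W -> dsum W}) (F : {linear dsum P -> dsum W}) :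
  homogeneous d dP -> homogeneous d dW -> homogeneous e F ->
  homogeneous (e + d) (bracket dP dW F).
Proof.
move=> hP hW hF; apply: homogeneousD; first exact: homogeneous_comp hF hW.
by apply: homogeneousN; rewrite addrC; apply: homogeneous_comp hP hF.
Qed.

Lemma homogeneous_defect m : homogeneous ((2 * m)%N%:Z - 1) (defect m).
Proof.
apply: homogeneousD; first exact: homogeneous_bracket.
case: m => [|m].
  by move=> p x hx r hr; rewrite /bracket /= linear0 subr0.
have -> : (2 * m.+1)%N%:Z - 1 = (2 * m)%N%:Z + 1.
  by rewrite mulnS addnC PoszD -addrA.
exact: homogeneous_bracket.
Qed.

Lemma homogeneous_correction m : homogeneous ((2 * m)%N%:Z - 1) (correction m).
Proof.
elim: m => [|m IH] p x hx r hr; first by rewrite /correction big_geq.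
have hcor : homogeneous ((2 * m.+1)%N%:Z - 1) (BW \o (phi \o correction m)).
  have -> : (2 * m.+1)%N%:Z - 1 = (2 * m)%N%:Z - 1 + 1 + 1.
    by rewrite mulnS addnC PoszD subrK -addrA.
  exact: homogeneous_comp (homogeneous_comp IH hphi) hBW.
rewrite correctionS.
exact: (homogeneousD (@homogeneous_defect m.+1) hcor hx hr).
Qed.

Lemma homogeneous_corrected m :
  homogeneous (2 * m)%N%:Z (fun x => f m x + phi (correction m x)).
Proof.
apply: homogeneousD => //; rewrite -[_%:Z](subrK 1).
exact: homogeneous_comp (@homogeneous_correction m) hphi.
Qed.

End Homogeneity.

Hypotheses (bb : forall x, b (b x) = 0) (BB : forall x, B (B x) = 0).
Hypothesis bB : forall x, b (B x) = - B (b x).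
Hypotheses (bbW : forall y, bW (bW y) = 0) (BBW : forall y, BW (BW y) = 0).
Hypothesis bBW : forall y, bW (BW y) = - BW (bW y).

(** The component of [[b + B, [b + B, f]] = 0]: [[b, [b, f_(m+1)]]] and
    [[B, [B, f_(m-1)]]] vanish separately, and the two mixed brackets of [f_m]
    cancel each other. *)
Lemma defect_cocycle m x :
  bW (defect m.+1 x) + defect m.+1 (b x) +
  (BW (defect m x) + defect m (B x)) = 0.
Proof.
rewrite /defect /=; have [H ->] := shift_index_linear m.
rewrite (linearD bW) (linearD BW) /= [X in X + _]addrACA bracket_square0 // add0r.
by rewrite [X in _ + X]addrACA bracket_square0 // addr0 bracket_anticommute.
Qed.

Variable j : {linear dsum W -> dsum Wbar}.
Hypothesis jBW : forall y, j y = 0 -> j (BW y) = 0.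
Hypothesis jphi : forall y, j (phi y) = 0.
Hypothesis contraction :
  forall y, j y = 0 -> y + bW (phi y) + phi (bW y) = 0.
Hypothesis jdefect : forall m x, j (defect m x) = 0.
Hypothesis defect0 : forall x, defect 0 x = 0.

(** Unlike [correctionS], this also covers rank 0, where both sides vanish. *)
Lemma correctionE m x :
  correction m x = defect m x + BW (phi (shift_index correction m x)).
Proof.
case: m => [|m]; last exact: correctionS.
by rewrite /correction big_geq // defect0 !linear0 addr0.
Qed.

Lemma jcorrection m x : j (correction m x) = 0.
Proof. by rewrite correctionE linearD /= jdefect jBW ?addr0. Qed.

(** The left-hand side at rank [m+1] is the sum of the left-hand side of
    [defect_cocycle] and of [BW phi] applied to the left-hand side at rank
    [m]. *)
Lemma correction_cocycle m x :
  bW (correction m x) + correction m (b x) + shift_index correction m (B x) = 0.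
Proof.
elim: m x => [|m IH] x.
  by rewrite /correction !big_geq //= linear0 !addr0.
(* By the contraction, - bW phi S = S + phi bW S; moreover BW S = BW e, since
   BW BW = 0. *)
have bBphi : bW (BW (phi (correction m x))) =
    BW (defect m x) + BW (phi (bW (correction m x))).
  have /eqP := contraction (jcorrection m x).
  rewrite bBW addrAC addr_eq0 => /eqP /(congr1 BW) eqB.
  by rewrite -linearN -eqB linearD /= {1}correctionE linearD /= BBW addr0.
transitivity (bW (defect m.+1 x) + defect m.+1 (b x) +
  (BW (defect m x) + defect m (B x)) +
  BW (phi (bW (correction m x) + correction m (b x) +
           shift_index correction m (B x)))); last first.
  by rewrite defect_cocycle IH !linear0 addr0.
have BphiD y z : BW (phi (y + z)) = BW (phi y) + BW (phi z).
  by rewrite !linearD.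
rewrite /= !correctionS [X in _ + X = _]correctionE !BphiD.
rewrite [bW (_ + BW _)]linearD /= bBphi.
by rewrite (AC ((1*2)*2*2) (((1*4)*(2*6))*((3*5)*7))).
Qed.

(** The left-hand side is [S m + bW (phi (S m)) - phi (S m (b x) + S (m-1) (B x))],
    and [correction_cocycle] turns the last term into [phi (bW (S m))]: the
    result is the contraction identity at [S m], an element of the kernel of
    [j]. *)
Lemma corrected_cocycle m x :
  let h i x := f i x + phi (correction i x) in
  bracket b bW (h m) x + bracket B BW (shift_index h m) x = 0.
Proof.
move=> h; have h'E z : shift_index h m z =
    shift_index (fun i => f i) m z + phi (shift_index correction m z).
  by case: (m) => [|i] //=; rewrite linear0 addr0.
have /eqP := correction_cocycle m x; rewrite -addrA addr_eq0 => /eqP eqS.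
rewrite -[RHS](contraction (jcorrection m x)) eqS {1}correctionE.
rewrite /defect /bracket !h'E /h !linearN !linearD /=.
by rewrite (AC (2*2*(2*2)) (((1*3)*(5*7))*6*2*(4*8))).
Qed.

End Correction.

Theorem mainTheorem8 (k : comPzRingType) (Q : cyclicModule k)
    (phi : {linear dsum Q -> dsum Q})
    (P : nat -> lmodType k) (b B : {linear dsum P -> dsum P})
    (f : nat -> {linear dsum P -> dsum Q}) :
  special_homotopy phi ->
  homogeneous (-1) b -> homogeneous 1 B ->
  (forall x, b (b x) = 0) -> (forall x, B (B x) = 0) ->
  (forall x, b (B x) = - B (b x)) ->
  (forall m, homogeneous (2 * m)%N%:Z (f m)) ->
  let g := fun m x => jQ Q (f m x) in
  (forall m x,
     bracket b (bbar Q) (g m) x + bracket B (Bbar Q) (shift_index g m) x = 0) ->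
  (forall x, bracket b (bQ Q) (f 0%N) x = 0) ->
  let h := hmap phi b B (fun m => f m) in
  (forall m, linear (h m)) /\
  (forall m, homogeneous (2 * m)%N%:Z (h m)) /\
  (forall m x, jQ Q (h m x) = g m x) /\
  (forall m x,
     bracket b (bQ Q) (h m) x + bracket B (BQ Q) (shift_index h m) x = 0) /\
  (forall x, h 0%N x = f 0%N x).
Proof.
move=> [hphi [i [_ [_ [_ [ij [_ [jphi _]]]]]]]] hb hB bb BB bB hf g hg hf0 h.
have defect0 x : defect b B (bQ Q) (BQ Q) f 0 x = 0.
  by rewrite /defect hf0 /bracket /= linear0 subr0 addr0.
have jdefect m x : jQ Q (defect b B (bQ Q) (BQ Q) f m x) = 0.
  have jf z : jQ Q (shift_index (fun i => f i) m z) = shift_index g m z.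
    by case: (m) => //=; rewrite linear0.
  rewrite -[RHS](hg m x) /defect /bracket linearD 2!(linearB (jQ Q)) /=.
  by rewrite jQ_bQ jQ_BQ !jf.
have jBQ y : jQ Q y = 0 -> jQ Q (BQ Q y) = 0.
  by move=> hy; rewrite jQ_BQ hy linear0.
have contraction y : jQ Q y = 0 -> y + bQ Q (phi y) + phi (bQ Q y) = 0.
  by move=> hy; rewrite -ij hy linear0.
have hE m x : h m x = f m x + phi (correction b B (bQ Q) (BQ Q) phi f m x) by [].
split=> [m a x y|].
  by rewrite !hE correction_linear !linearP /= scalerDr addrACA.
split=> [m|].
  apply: homogeneous_corrected => //.
    exact: homogeneous_bQ.
  exact: homogeneous_BQ.
split=> [m x|]; first by rewrite /h /hmap linearD /= jphi addr0.
split=> [m x|x]; last by rewrite /h /hmap big_geq // linear0 addr0.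
exact: (corrected_cocycle bb BB bB (@bQ_bQ _ Q) (@BQ_BQ _ Q) (@bQ_BQ _ Q)
          jBQ jphi contraction jdefect defect0).
Qed.
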